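(* Let $n\ge 2$ and let $x_1,x_2,\dots,x_n$ be $n$ positive real numbers, with arithmetic mean $A$, geometric mean $G$ and second moment $m_2'$. Then $$G\leq \sqrt{\frac{nA^{2}-m_{2}'}{n-1}}\leq A.$$
   Context: For positive real numbers $x_1,\dots,x_n$: $A=\frac1n\sum_{i=1}^n x_i$, $G=\left(\prod_{i=1}^n x_i\right)^{1/n}$, and $m_2'=\frac1n\sum_{i=1}^n x_i^2$. *)

(* Defs.v *)
From mathcomp Require Import all_boot all_order all_algebra.
From mathcomp Require Import all_classical all_reals exp.

Set Implicit Arguments.
Unset Strict Implicit.
Unset Printing Implicit Defensive.

Import Order.TTheory GRing.Theory Num.Theory.
Local Open Scope ring_scope.

Definition arith_mean (R : realType) (n : nat) (x : 'I_n -> R) : R :=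
  n%:R^-1 * \sum_(i < n) x i.

Definition geom_mean (R : realType) (n : nat) (x : 'I_n -> R) : R :=
  (\prod_(i < n) x i) `^ (n%:R^-1).

(* The raw (not centered) second moment. *)
Definition second_moment (R : realType) (n : nat) (x : 'I_n -> R) : R :=
  n%:R^-1 * \sum_(i < n) x i ^+ 2.

(* Main.v *)
(** Since [n * A = \sum_i x i], the quantity under the square root is the
    average of the [n * (n - 1)] products [x i * x j] over ordered pairs of
    distinct indices. The product of all of these is [G ^ (2 n (n - 1))], so
    AM-GM bounds their average below by [G ^ 2]. The upper bound reduces to
    [A ^ 2 <= m_2'], i.e. to the nonnegativity of the variance. *)
Require Import Defs.
From mathcomp Require Import all_boot all_order all_algebra.
From mathcomp Require Import all_classical all_reals exp.
From mathcomp Require Import ring lra.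

Import Order.TTheory GRing.Theory Num.Theory.
Local Open Scope ring_scope.

Lemma card_offdiag (n : nat) :
  #|[pred p : 'I_n * 'I_n | p.1 != p.2]| = (n * n.-1)%N.
Proof.
rewrite -sum1_card /=.
under eq_bigl do rewrite inE.
rewrite -(pair_big_dep predT (fun i j : 'I_n => i != j) (fun _ _ => 1%N)) /=.
under eq_bigr => i _.
  rewrite sum1_card (eq_card (B := [predC pred1 i])); last first.
    by move=> j; rewrite !inE eq_sym.
  rewrite cardC1 card_ord; over.
by rewrite sum_nat_const card_ord.
Qed.

(** Expanding the squared sum gives all ordered pairs, and the diagonal ones contribute the
    squares. *)
Lemma sum_offdiag_mul (R : comPzRingType) (n : nat) (x : 'I_n -> R) :
  \sum_(p : 'I_n * 'I_n | p.1 != p.2) x p.1 * x p.2 =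
  (\sum_i x i) ^+ 2 - \sum_i x i ^+ 2.
Proof.
rewrite -(pair_big_dep predT (fun i j => i != j) (fun i j => x i * x j)) /=.
rewrite expr2 mulr_suml -sumrB; apply: eq_bigr => i _.
rewrite mulr_sumr [in RHS](bigD1 i) //= expr2 addrAC subrr add0r.
by apply: eq_bigl => j; rewrite eq_sym.
Qed.

(** Each [x k] occurs [n.-1] times as a first factor and [n.-1] times as a second one. *)
Lemma prod_offdiag_mul (R : comPzRingType) (n : nat) (x : 'I_n -> R) :
  \prod_(p : 'I_n * 'I_n | p.1 != p.2) (x p.1 * x p.2) =
  (\prod_i x i) ^+ (2 * n.-1).
Proof.
have prod_const i : \prod_(j < n | i != j) x i = x i ^+ n.-1.
  rewrite prodr_const (eq_card (B := [predC pred1 i])) ?cardC1 ?card_ord //.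
  by move=> j; rewrite !inE eq_sym.
rewrite -(pair_big_dep predT (fun i j => i != j) (fun i j => x i * x j)) /=.
under eq_bigr do rewrite big_split /= prod_const.
(* For the second factors, exchanging the two products makes the inner one constant. *)
rewrite big_split /= (exchange_big_dep predT) //=.
under [X in _ * X]eq_bigr => j _.
  under eq_bigl do rewrite eq_sym.
  rewrite prod_const; over.
by rewrite prodrXl mul2n -addnn exprD.
Qed.

Lemma geom_mean_expn (R : realType) (n : nat) (x : 'I_n -> R) :
  (0 < n)%N -> (forall i, 0 <= x i) -> geom_mean x ^+ n = \prod_i x i.
Proof.
move=> n_gt0 x_ge0; have P_ge0 : 0 <= \prod_i x i by apply: prodr_ge0.
rewrite /geom_mean -powR_mulrn ?powR_ge0 // -powRrM mulVf ?powRr1 //.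
by rewrite pnatr_eq0 -lt0n.
Qed.

Lemma arith_mean_sqr_le (R : realType) (n : nat) (x : 'I_n -> R) :
  (0 < n)%N -> arith_mean x ^+ 2 <= second_moment x.
Proof.
move=> n_gt0; have n_pos : 0 < n%:R :> R by rewrite ltr0n.
have sumE : \sum_i x i = n%:R * arith_mean x.
  by rewrite /arith_mean mulVKf ?gt_eqF.
set A := arith_mean x in sumE *.
rewrite /second_moment mulrC ler_pdivlMr // -subr_ge0.
(* By [sumE], the cross term of the squared deviations sums to [-2 n A ^ 2]. *)
suff -> : \sum_i x i ^+ 2 - A ^+ 2 * n%:R = \sum_i (x i - A) ^+ 2.
  by apply: sumr_ge0 => i _; apply: sqr_ge0.
under [RHS]eq_bigr do rewrite sqrrB.
rewrite big_split /= sumrB sumrMnl -mulr_suml sumE sumr_const card_ord.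
by ring.
Qed.

Theorem theorem2p2 (R : realType) (n : nat) (x : 'I_n -> R)
    (hn : (2 <= n)%N) (hx : forall i : 'I_n, 0 < x i) :
  geom_mean x <=
    Num.sqrt ((n%:R * arith_mean x ^+ 2 - second_moment x) / (n%:R - 1))
  /\ Num.sqrt ((n%:R * arith_mean x ^+ 2 - second_moment x) / (n%:R - 1))
    <= arith_mean x.
Proof.
have n_gt0 : (0 < n)%N by apply: ltnW.
have n_pos : 0 < n%:R :> R by rewrite ltr0n.
have n1_pos : 0 < n%:R - 1 :> R by rewrite subr_gt0 ltr1n.
have x_ge0 i : 0 <= x i by apply: ltW.
have A_ge0 : 0 <= arith_mean x by rewrite mulr_ge0 ?invr_ge0 ?sumr_ge0 // ltW.
have G_ge0 : 0 <= geom_mean x by apply: powR_ge0.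
set V := _ / _; split; last first.
  rewrite -(ger0_norm A_ge0) -sqrtr_sqr ler_wsqrtr // /V ler_pdivrMr //.
  by have := @arith_mean_sqr_le R n x n_gt0; lra.
have VE : V =
    (\sum_(p : 'I_n * 'I_n | p.1 != p.2) x p.1 * x p.2) / (n * n.-1)%:R.
  rewrite sum_offdiag_mul /V /arith_mean /second_moment natrM -subn1 natrB //.
  by field; rewrite !gt_eqF.
have V_ge0 : 0 <= V.
  by rewrite VE divr_ge0 // sumr_ge0 // => p _; rewrite mulr_ge0.
have N_gt0 : (0 < n * n.-1)%N by rewrite muln_gt0 n_gt0 -subn1 subn_gt0.
rewrite -(ger0_norm G_ge0) -sqrtr_sqr ler_wsqrtr //.
(* [leif_AGM] is free of roots: it bounds a product by the mean raised to the number of factors.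
   Hence the power [n * n.-1]; [V_ge0] makes the passage to powers reversible. *)
rewrite -(ler_pXn2r N_gt0) ?nnegrE ?sqr_ge0 //.
(* The exponent [2 * (n * n.-1)] is regrouped as [n * (2 * n.-1)] to expose [geom_mean x ^+ n]. *)
rewrite -exprM mulnCA exprM geom_mean_expn // -prod_offdiag_mul VE -card_offdiag.
by apply: leif_AGM => p _; rewrite mulr_ge0.
Qed.
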